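(* Let $\lambda=(\lambda_k)_{k\ge 0}$ be a strictly increasing sequence of positive real numbers tending to $\infty$, with $\lambda_{-1}=0$, and let $p=(p_k)_{k\ge 0}$ be a sequence of real numbers with $1\le p_k\le H<\infty$ for all $k$. Then the inclusion $\ell(\lambda,p)\subset\ell(p)$ holds if and only if $S(x)\in\ell(p)$ for every sequence $x\in\ell(\lambda,p)$.
   Context: For a real sequence $x=(x_k)_{k\ge0}$ put $\Lambda_n(x)=\frac{1}{\lambda_n}\sum_{k=0}^{n}(\lambda_k-\lambda_{k-1})x_k$. Define $\ell(p)=\{x\in\mathbb{R}^{\mathbb{N}}:\sum_{n=0}^\infty|x_n|^{p_n}<\infty\}$ and $\ell(\lambda,p)=\{x\in\mathbb{R}^{\mathbb{N}}:\sum_{n=0}^\infty|\Lambda_n(x)|^{p_n}<\infty\}$. The sequence $S(x)=(S_n(x))_{n\ge0}$ is defined by $S_0(x)=0$ and $S_n(x)=\frac{1}{\lambda_n}\sum_{k=1}^{n}\lambda_{k-1}(x_k-x_{k-1})$ for $n\ge1$. *)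

(* Defs.v *)
(* MathComp / MathComp-Analysis. *)
From mathcomp Require Import all_boot all_order all_algebra.
From mathcomp Require Import all_classical all_reals all_analysis.

Set Implicit Arguments.
Unset Strict Implicit.
Unset Printing Implicit Defensive.

Import Order.TTheory GRing.Theory Num.Theory.
Import numFieldNormedType.Exports.
Local Open Scope classical_set_scope.
Local Open Scope ring_scope.

(* The shifted sequence k |-> lam_{k-1}, with the convention lam_{-1} = 0
   (hence not lam k.-1, which would be lam_0 at k = 0). *)
Definition lam_prev {R : realType} (lam : R^nat) (k : nat) : R :=
  if k is j.+1 then lam j else 0.

Definition Lambda {R : realType} (lam x : R^nat) : R^nat :=
  fun n => (lam n)^-1 * \sum_(0 <= k < n.+1) (lam k - lam_prev lam k) * x k.

(* The power is powR, for which 0 `^ a = 0 as soon as a != 0; the terms are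
   nonnegative, so convergence of the series is finiteness of its sum. *)
Definition ell {R : realType} (p : R^nat) : set (R^nat) :=
  [set x | cvgn (series (fun n => `|x n| `^ p n))].

Definition ell_lambda {R : realType} (lam p : R^nat) : set (R^nat) :=
  [set x | cvgn (series (fun n => `|Lambda lam x n| `^ p n))].

Definition S_seq {R : realType} (lam x : R^nat) : R^nat :=
  fun n => if n is 0%N then 0 else
    (lam n)^-1 * \sum_(1 <= k < n.+1) lam k.-1 * (x k - x k.-1).

(* Main.v *)
(* Summation by parts gives x = Lambda(x) + S(x), and ell(p) is closed under
   sums and differences because p is bounded. *)
Require Import Defs.
From mathcomp Require Import all_boot all_order all_algebra.
From mathcomp Require Import all_classical all_reals all_analysis.

Import Order.TTheory GRing.Theory Num.Theory.
Import numFieldNormedType.Exports.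
Local Open Scope classical_set_scope.
Local Open Scope ring_scope.

(** By [Lambda_add_S_seq], [x] and [S_seq lam x] differ by [Lambda lam x], which lies in [ell p]
    exactly when [x] is in [ell_lambda lam p]. Since [ell p] is an additive group ([ellD], [ellN]),
    for such [x] one of the two lies in it iff the other does. *)

(** The sum is at most twice the larger term. Bounding [2 ^ q] by [2 ^ H] makes the constant uniform
    in the exponent, so a single comparison of series serves all the varying [p n]. *)
Lemma powR_normD_le (R : realType) (a b q H : R) : 0 <= q <= H ->
  `|a + b| `^ q <= 2 `^ H * (`|a| `^ q + `|b| `^ q).
Proof.
move=> /andP[q0 qH].
wlog le_ba : a b / `|b| <= `|a|.
  move=> W; case: (leP `|b| `|a|) => [|/ltW] h; first exact: W.
  by rewrite addrC [X in _ * X]addrC; exact: W.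
have le_2a : `|a + b| <= 2 * `|a|.
  by rewrite (le_trans (ler_normD _ _))// mulr_natl mulr2n lerD2l.
apply: (le_trans (ge0_ler_powR q0 _ _ le_2a)); rewrite ?nnegrE ?mulr_ge0//.
rewrite powRM// ler_pM ?powR_ge0 ?lerDl ?powR_ge0//.
by rewrite ler_powR// ler1n.
Qed.

Lemma ellD (R : realType) (p x y : nat -> R) (H : R) :
  (forall n, 0 <= p n <= H) -> ell p x -> ell p y ->
  ell p (fun n => x n + y n).
Proof.
move=> pH xp yp; apply: (@series_le_cvg _ _
  (2 `^ H *: ((fun n => `|x n| `^ p n) + (fun n => `|y n| `^ p n)))).
- by move=> n; exact: powR_ge0.
- by move=> n; rewrite mulr_ge0 ?addr_ge0 ?powR_ge0.
- by move=> n; exact: powR_normD_le.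
- by apply: is_cvg_seriesZ; exact: is_cvg_seriesD.
Qed.

Lemma ellN (R : realType) (p x : nat -> R) :
  ell p x -> ell p (fun n => - x n).
Proof. by rewrite /ell /=; under [in X in _ -> X]eq_fun do rewrite normrN. Qed.

Lemma Lambda_add_S_seq (R : realType) (lam x : nat -> R) (n : nat) :
  lam n != 0 -> x n = Lambda lam x n + S_seq lam x n.
Proof.
(* Cleared of denominators, the identity can be proved by induction for every [m], although only
   [lam n] is known to be nonzero. *)
move=> lam_neq0; suff parts m : lam m * x m =
    \sum_(0 <= k < m.+1) (lam k - lam_prev lam k) * x k +
    \sum_(1 <= k < m.+1) lam k.-1 * (x k - x k.-1).
  apply: (mulfI lam_neq0); rewrite parts mulrDr /Lambda mulVKf//; congr (_ + _).
  by case: n lam_neq0 => [|n] ?; rewrite /S_seq ?mulVKf// big_geq ?mulr0.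
(* The base case relies on the convention that [lam_prev lam 0] is 0. *)
elim: m => [|m IH]; first by rewrite big_nat1 big_geq//= subr0 addr0.
rewrite big_nat_recr//= [X in _ + X]big_nat_recr//= addrACA -IH.
by rewrite mulrBl mulrBr [X in _ + X]addrA subrK addrC subrK.
Qed.

Theorem theorem4 (R : realType) (lam p : R^nat) (H : R)
  (lam_gt0 : forall k : nat, 0 < lam k)
  (lam_incr : {homo lam : m n / (m < n)%N >-> m < n})
  (lam_infty : lam n @[n --> \oo] --> +oo)
  (p_bounds : forall k : nat, 1 <= p k <= H) :
  ell_lambda lam p `<=` ell p <->
  (forall x : R^nat, ell_lambda lam p x -> ell p (S_seq lam x)).
Proof.
have pH n : 0 <= p n <= H.
  by have /andP[/(le_trans ler01) -> ->] := p_bounds n.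
have xE x n : x n = Lambda lam x n + S_seq lam x n.
  by apply: Lambda_add_S_seq; rewrite gt_eqF.
split=> [sub x xl|Sp x xl].
- have -> : S_seq lam x = fun n => x n + - Lambda lam x n.
    by apply/funext => n; rewrite [x n]xE addrAC subrr add0r.
  (* The hypothesis [xl] is, by unfolding, membership of [Lambda lam x] in [ell p]. *)
  by apply: (ellD _ _ _ _ _ pH); [exact: sub | exact: ellN].
- by rewrite (funext (xE x)); apply: (ellD _ _ _ _ _ pH) => //; exact: Sp.
Qed.
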